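(* Let $g\in\mathcal{G}$. If the equation $Bf=g$ has a solution $f\in\mathcal{F}$ and this solution is unique, then $$\{(\partial^\circ g)^{-1}(y)\}_{y\in\mathrm{ldom}(B^\circ g)}\ \text{ is a topologically minimal covering of }X'\cap\mathrm{udom}(g),$$ provided one of the following assertions is satisfied: (1) $X'=\mathrm{dom}(\partial^\circ g)$, and $Y$ is discrete; (2) $X'=\mathrm{dom}(\partial^\circ g)$, $Y$ is locally compact, $b$ is continuous in the second variable, and $B^\circ g(y)>-\infty$ for all $y\in Y$; (3) $X'=\mathrm{idom}(g)$, $b$ is coercive, $B$ is regular, $b$ is continuous in the second variable, $B^\circ g(y)>-\infty$ for all $y\in Y$, $\mathrm{dom}(g)$ is included in the closure of $\mathrm{idom}(g)$, and either $Y$ is locally compact or condition $(\mathcal{C})$ holds.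
   Context: Setting. $\overline{\mathbb{R}}=\mathbb{R}\cup\{\pm\infty\}$ with its usual order and topology. $X,Y$ are nonempty Hausdorff topological spaces, $\mathcal{F}=\mathrm{lsc}(Y,\overline{\mathbb{R}})$ is the set of lower semicontinuous functions $Y\to\overline{\mathbb{R}}$, $\mathcal{G}=\overline{\mathbb{R}}^X$ is the set of all functions $X\to\overline{\mathbb{R}}$, both with the pointwise order. $(B,B^\circ)$, $B:\mathcal{F}\to\mathcal{G}$, $B^\circ:\mathcal{G}\to\mathcal{F}$, is a dual Galois connection: $g\geq Bf\iff f\geq B^\circ g$ for all $f\in\mathcal{F},g\in\mathcal{G}$. Its kernels are the (unique) maps $b:X\times Y\times\overline{\mathbb{R}}\to\overline{\mathbb{R}}$, $b^\circ:Y\times X\times\overline{\mathbb{R}}\to\overline{\mathbb{R}}$ such that for all $(x,y)$, $(b(x,y,\cdot),b^\circ(y,x,\cdot))$ is a dual Galois connection between $\overline{\mathbb{R}}$ and $\overline{\mathbb{R}}$ (i.e. $t\geq b(x,y,s)\iff s\geq b^\circ(y,x,t)$), $b^\circ(\cdot,x,t)\in\mathcal{F}$ for all $x,t$, and $Bf(x)=\sup_{y\in Y}b(x,y,f(y))$, $B^\circ g(y)=\sup_{x\in X}b^\circ(y,x,g(x))$. Standing assumptions. There is a subset $\mathcal{S}\subset X\times Y$ such that: (A1) $\mathcal{S}_x=\{y\in Y\mid(x,y)\in\mathcal{S}\}\neq\emptyset$ for all $x\in X$; (A2) $\mathcal{S}^y=\{x\in X\mid(x,y)\in\mathcal{S}\}\neq\emptyset$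 for all $y\in Y$; (A3) $b(x,y,\cdot)$ is a bijection $\overline{\mathbb{R}}\to\overline{\mathbb{R}}$ for all $(x,y)\in\mathcal{S}$; (A4) $b(x,y,\cdot)\equiv-\infty$ for $(x,y)\in(X\times Y)\setminus\mathcal{S}$. Domains. For $h:Z\to\overline{\mathbb{R}}$, $Z$ a topological space: $\mathrm{ldom}(h)=\{z\mid h(z)<+\infty\}$, $\mathrm{udom}(h)=\{z\mid h(z)>-\infty\}$, $\mathrm{dom}(h)=\mathrm{ldom}(h)\cap\mathrm{udom}(h)$, $\mathrm{idom}(h)=\{z\in\mathrm{dom}(h)\mid\limsup_{z'\to z}h(z')<+\infty\}$. Subdifferential of $g\in\mathcal{G}$ at $x\in X$: $\partial^\circ g(x)=\{y\in Y\mid(x,y)\in\mathcal{S},\ b^\circ(y,x',g(x'))\leq b^\circ(y,x,g(x))\ \forall x'\in X\}$; $\mathrm{dom}(\partial^\circ g)=\{x\in X\mid\partial^\circ g(x)\neq\emptyset\}$ and $(\partial^\circ g)^{-1}(y)=\{x\in X\mid y\in\partial^\circ g(x)\}$. Coverings. For a map $F$ from a set $Z$ to the set of subsets of $W$, $Z'\subset Z$, $W'\subset W$: $\{F(z)\}_{z\in Z'}$ is a covering of $W'$ if $\bigcup_{z\in Z'}F(z)\supset W'$. When $Z$ is a topological space, $y\in Z'$ is topologically essential with respect to this covering if for all open neighbourhoods $U$ of $y$ in $Z'$ (induced topology) there is $w\in W'$ with $w\notin\bigcup_{z\in Z'\setminus U}F(z)$. The covering is topologically minimal if all elements of $Z'$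 are topologically essential. $b$ is continuous in the second variable if $b(x,\cdot,\alpha)$ is continuous for all $x\in X$, $\alpha\in\mathbb{R}$. $b$ is coercive if for all $x\in X$, all neighbourhoods $V$ of $x$ in $X$ and all $\alpha\in\mathbb{R}$, the function $b^\alpha_{x,V}(y)=\sup_{z\in V}b(z,y,b^\circ(y,x,\alpha))$ is such that $\{y\in Y\mid b^\alpha_{x,V}(y)\leq\beta\}$ is relatively compact for all $\beta\in\mathbb{R}$. A map $h:Z\to W$ between topological spaces is quasi-continuous if for every open $G\subset W$, $h^{-1}(G)$ is included in the closure of its interior. $B$ is regular if for all $f\in\mathcal{F}$, $Bf$ is l.s.c. on $X$ and quasi-continuous on its domain, meaning that the restriction of $Bf$ to $\mathrm{dom}(Bf)$ is quasi-continuous for the induced topology. Condition $(\mathcal{C})$: there exists a basis $\mathcal{B}$ of neighbourhoods in $Y$ such that for all $U\in\mathcal{B}$ there exists $\varepsilon>0$ such that for all $x\in X$, $\sup_{y\in U\cap\mathcal{S}_x,\ \alpha\in\mathbb{R}}\bigl(b(x,y,\alpha)-b(x,y,\alpha+\varepsilon)\bigr)<+\infty$. *)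

(* Defs.v *)
From mathcomp Require Import all_boot all_order all_algebra.
From mathcomp Require Import all_classical all_reals all_analysis.

Set Implicit Arguments.
Unset Strict Implicit.
Unset Printing Implicit Defensive.

Import Order.TTheory GRing.Theory Num.Theory.
Import numFieldNormedType.Exports.

Local Open Scope classical_set_scope.
Local Open Scope ring_scope.
Local Open Scope ereal_scope.

Section dual_galois_connections.

(* A map with domain [F] is represented by a total function, of which only the
   values on [F] are constrained. Function types carry the pointwise order. *)
Definition dual_galois d1 d2 (S : porderType d1) (T : porderType d2)
    (F : set S) (G : set T) (f : S -> T) (g : T -> S) : Prop :=
  [/\ forall s, F s -> G (f s),
      forall t, G t -> F (g t) &
      forall s t, F s -> G t -> (f s <= t)%O <-> (g t <= s)%O].

Definition lsc (R : realType) (Z : topologicalType) : set (Z -> \bar R) :=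
  [set f | lower_semicontinuous f].

End dual_galois_connections.

Section domains.
Context {R : realType} {Z : topologicalType}.
Implicit Type h : Z -> \bar R.

Definition ldom h : set Z := [set z | h z < +oo].
Definition udom h : set Z := [set z | -oo < h z].
Definition dom h : set Z := ldom h `&` udom h.

(* [nbhs z] is the full filter of neighbourhoods, so the limsup takes the value
   at [z] into account; since [h z < +oo] on [dom h], the punctured limsup
   would define the same set. *)
Definition idom h : set Z := [set z | dom h z /\ limf_esup h (nbhs z) < +oo].

End domains.

Section coverings.

Definition covering (Z W : Type) (F : Z -> set W) (Z' : set Z) (W' : set W) :=
  W' `<=` \bigcup_(z in Z') F z.

(* The open neighbourhoods of [y] in the induced topology of [Z'] are the
   [Z' `&` V] with [V] open in [Z] and containing [y]. *)
Definition topologically_essential (Z : topologicalType) (W : Type)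
    (F : Z -> set W) (Z' : set Z) (W' : set W) (y : Z) :=
  forall V : set Z, open V -> V y ->
    exists2 w, W' w & ~ (\bigcup_(z in Z' `\` (Z' `&` V)) F z) w.

Definition topologically_minimal_covering (Z : topologicalType) (W : Type)
    (F : Z -> set W) (Z' : set Z) (W' : set W) :=
  covering F Z' W' /\ forall y, Z' y -> topologically_essential F Z' W' y.

End coverings.

Definition quasi_continuous (Z W : topologicalType) (h : Z -> W) :=
  forall G : set W, open G -> h @^-1` G `<=` closure (interior (h @^-1` G)).

Definition discrete_topological_space (Z : topologicalType) :=
  forall A : set Z, open A.

Definition neighbourhood_basis (Z : topologicalType) (N : set (set Z)) :=
  forall (z : Z) (V : set Z), nbhs z V ->
    exists2 U, N U /\ nbhs z U & U `<=` V.

Section kernels.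
Context {R : realType} {X Y : topologicalType}.
Implicit Types (B : (Y -> \bar R) -> (X -> \bar R))
  (Bo : (X -> \bar R) -> (Y -> \bar R))
  (b : X -> Y -> \bar R -> \bar R) (bo : Y -> X -> \bar R -> \bar R)
  (S : set (X * Y)) (g : X -> \bar R).

Definition kernels B Bo b bo : Prop :=
  [/\ forall x y, dual_galois setT setT (b x y) (bo y x),
      forall x t, lsc (fun y => bo y x t),
      forall f x, lsc f -> B f x = ereal_sup [set b x y (f y) | y in setT] &
      forall g y, Bo g y = ereal_sup [set bo y x (g x) | x in setT]].

Definition subdiff S bo g (x : X) : set Y :=
  [set y | S (x, y) /\ forall x', bo y x' (g x') <= bo y x (g x)].

Definition dom_subdiff S bo g : set X := [set x | subdiff S bo g x !=set0].

Definition subdiff_inv S bo g (y : Y) : set X := [set x | subdiff S bo g x y].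

Definition continuous_in_second_variable b :=
  forall x (a : R), continuous (fun y => b x y a%:E).

Definition coercive b bo :=
  forall (x : X) (V : set X) (a : R), nbhs x V ->
    forall c : R, precompact
      [set y | ereal_sup [set b z y (bo y x a%:E) | z in V] <= c%:E].

Definition regular B :=
  forall f, lsc f ->
    lsc (B f) /\
    quasi_continuous (fun x : set_type (dom (B f)) => B f (set_val x)).

(* If [b x y] is bijective for [S (x, y)], it is a decreasing bijection of
   [\bar R], hence finite at finite points: the difference is one of reals. *)
Definition condition_C S b :=
  exists N : set (set Y), neighbourhood_basis N /\
    forall U, N U -> exists2 e : R, (0 < e)%R &
      forall x, ereal_sup [set b x y a%:E - b x y (a + e)%:E
                          | y in U `&` xsection S x & a in [set: R]] < +oo.

End kernels.

(* Main.v *)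
(* If [B f = g] is solvable, [Bo g] is a solution, so it is the only one, [f].
   By bijectivity of [b x y], [y] belongs to the subdifferential at [x] iff the
   supremum [g x] of [b x y (f y)] over [y] is attained at [y]. Suppose that the
   covering survives the removal of a neighbourhood [V] of [y0] from [ldom f].
   Increase [f] on a small open neighbourhood [U] of [y0] inside [V]: up to
   [+oo] in the cases (1) and (2), by a constant in the case (3). The resulting
   [k] is lower semicontinuous and differs from [f] at [y0], so it suffices that
   [B k = g]. Where the supremum is attained outside [V], nothing changes. Where
   it is not attained at all, upper semicontinuity of [b x y (f y)] in [y] keeps
   it away from [g x] on a compact neighbourhood of [y0], so removing [U]
   inside this compact changes nothing either. In the case (3), coercivity shows
   that the supremum is attained on [idom g], and quasi-continuity of [B k]
   propagates [B k = g] from there to [dom g]. *)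
Require Import Defs.
From mathcomp Require Import all_boot all_order all_algebra.
From mathcomp Require Import all_classical all_reals all_analysis.

Import Order.TTheory GRing.Theory Num.Theory.
Import numFieldNormedType.Exports.

Local Open Scope classical_set_scope.
Local Open Scope ring_scope.
Local Open Scope ereal_scope.

(** * Dual Galois connections on the extended reals *)

Section dual_galois_ereal.
Context {R : realType} {u v : \bar R -> \bar R}.
Hypothesis uv : dual_galois setT setT u v.

Lemma dual_galoisE s t : u s <= t <-> v t <= s.
Proof. by case: uv => _ _; apply. Qed.

Lemma dual_galois_anti s t : s <= t -> u t <= u s.
Proof. by move=> st; apply/dual_galoisE/(le_trans _ st)/dual_galoisE. Qed.

Lemma dual_galois_pinfty : u +oo = -oo.
Proof. by apply/eqP; rewrite -leeNy_eq; apply/dual_galoisE/leey. Qed.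

Hypothesis u_bij : bijective u.

(** Any dual Galois connection satisfies [u (v (u s)) = u s]; injectivity cancels the outer [u]. *)
Lemma dual_galoisK : cancel u v.
Proof.
move=> s; apply: (bij_inj u_bij); apply/eqP; rewrite eq_le; apply/andP; split.
  by apply/dual_galoisE.
by apply: dual_galois_anti; apply/dual_galoisE.
Qed.

Lemma dual_galoisVK : cancel v u.
Proof. by case: u_bij => w _ wK t; rewrite -(wK t) dual_galoisK. Qed.

Lemma dual_galois_lt s t : s < t -> u t < u s.
Proof.
move=> st; rewrite lt_neqAle dual_galois_anti ?ltW // andbT.
by apply: contraTneq st => /(bij_inj u_bij) ->; rewrite ltxx.
Qed.

Lemma dual_galois_gtNy s : s < +oo -> -oo < u s.
Proof. by move=> /dual_galois_lt; apply: le_lt_trans; rewrite leNye. Qed.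

End dual_galois_ereal.

(** * Semicontinuity and suprema over compact sets *)

Section semicontinuity.
Context {R : realType} {Y : topologicalType}.
Implicit Types (f h phi : Y -> \bar R) (K U : set Y).

Lemma lsc_patch f h U : open U -> lsc f -> lsc h -> (forall y, f y <= h y) ->
  lsc (patch f U h).
Proof.
move=> Uo /lower_semicontinuousP fl /lower_semicontinuousP hl fh.
apply/lower_semicontinuousP => a.
rewrite (_ : [set _ | _] = [set y | a%:E < f y] `|` U `&` [set y | a%:E < h y]).
  by apply: openU => //; exact: openI.
apply/seteqP; split=> y /=; rewrite /patch; case: ifPn => [/set_mem Uy|/negP Uy].
- by right.
- by left.
- by case=> [/lt_le_trans|[]//]; apply.
- by case=> // -[/mem_set].
Qed.

Lemma lsc_addr f (e : R) : lsc f -> lsc (fun y => f y + e%:E).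
Proof.
move=> /lower_semicontinuousP fl; apply/lower_semicontinuousP => a.
rewrite (_ : [set _ | _] = [set y | (a - e)%:E < f y]) //.
by apply/seteqP; split=> y /=; rewrite EFinB lteBlDr.
Qed.

Lemma lsc_cst (c : \bar R) : lsc (fun _ : Y => c).
Proof. by move=> y a ac; exists setT => //; exact: filterT. Qed.

(** The sets [above z] form a filter base because values are totally ordered; by closedness a
    cluster point in [K] lies in all of them. *)
Lemma usc_compact_max phi K : (forall a, closed [set y | a <= phi y]) ->
  compact K -> K !=set0 -> exists2 y, K y & forall z, K z -> phi z <= phi y.
Proof.
move=> phic cK [k Kk].
pose above z := [set y | K y /\ phi z <= phi y].
have PF : ProperFilter (filter_from K above).
  apply: filter_from_proper; last by move=> z Kz; exists z.
  apply: filter_from_filter; first by exists k.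
  move=> z w Kz Kw; have [zw|/ltW wz] := leP (phi z) (phi w).
    by exists w => // y [Ky wy]; do 2?split=> //; exact: le_trans wy.
  by exists z => // y [Ky zy]; do 2?split=> //; exact: le_trans zy.
have [|y [Ky clY]] := cK _ PF; first by exists k => // y [].
exists y => // z Kz; apply: phic => W yW.
by apply: (clY _ _ _ yW); exists z => // ? [].
Qed.

(** On a nonempty [K] the maximum of [phi] is strictly below the total supremum, so [K] cannot
    account for it. *)
Lemma ereal_sup_off_compact phi K : (forall a, closed [set y | a <= phi y]) ->
  compact K -> (forall y, K y -> phi y < ereal_sup (range phi)) ->
  ereal_sup (range phi) <= ereal_sup (phi @` (~` K)).
Proof.
move=> phic cK Klt; rewrite leNgt; apply/negP => lt.
have [K0|/set0P K0] := eqVneq K set0.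
  by move: lt; rewrite K0 setC0 ltxx.
have [y Ky ymax] := usc_compact_max phi K phic cK K0.
have : ereal_sup (range phi) <= Order.max (phi y) (ereal_sup (phi @` (~` K))).
  apply: ge_ereal_sup => _ [z _ <-]; rewrite le_max.
  have [/ymax -> //|Kz] := pselect (K z).
  by apply/orP; right; apply: ereal_sup_ubound; exists z.
by apply/negP; rewrite -ltNge gt_max Klt.
Qed.

End semicontinuity.

(** * Kernels, subdifferentials and attained suprema *)

Section kernels.
Context {R : realType} {X Y : topologicalType}.
Context {B : (Y -> \bar R) -> (X -> \bar R)} {Bo : (X -> \bar R) -> (Y -> \bar R)}.
Context {b : X -> Y -> \bar R -> \bar R} {bo : Y -> X -> \bar R -> \bar R}.
Context {S : set (X * Y)}.
Hypotheses (BBo : dual_galois (@lsc R Y) [set: X -> \bar R] B Bo)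
  (bbo : kernels B Bo b bo)
  (b_bij : forall x y, S (x, y) -> bijective (b x y))
  (b_Ny : forall x y, ~ S (x, y) -> forall s, b x y s = -oo).

Let kernel_galois x y : dual_galois setT setT (b x y) (bo y x).
Proof. by case: bbo. Qed.

Lemma kernel_dom x y s : -oo < b x y s -> S (x, y).
Proof. by apply: contraPP => /b_Ny ->; rewrite ltxx. Qed.

Lemma kernel_gtNy x y s : S (x, y) -> s < +oo -> -oo < b x y s.
Proof. by move=> Sxy; apply: dual_galois_gtNy (b_bij _ _ Sxy) _. Qed.

Lemma kernel_lty x y s : -oo < s -> b x y s < +oo.
Proof.
move=> s_gt; have [Sxy|/b_Ny ->] := pselect (S (x, y)); last by [].
apply: lt_le_trans (leey (b x y -oo)).
exact: dual_galois_lt (b_bij _ _ Sxy) _ _ _.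
Qed.

Lemma Bo_lsc g : lsc (Bo g).
Proof. by case: BBo => _ + _; apply. Qed.

Lemma B_ge f x y : lsc f -> b x y (f y) <= B f x.
Proof.
by case: bbo => _ _ BE _ fl; rewrite BE //; apply: ereal_sup_ubound; exists y.
Qed.

Lemma le_B f h x : lsc f -> lsc h -> (forall y, f y <= h y) -> B h x <= B f x.
Proof.
move=> fl hl fh; case: bbo => _ _ BE _; rewrite (BE h x hl).
apply: ge_ereal_sup => _ [y _ <-]; apply: le_trans (B_ge _ x y fl).
exact: dual_galois_anti.
Qed.

(** The connection gives [B (Bo g) <= g] and [Bo g <= f]; as [B] is antitone, the latter yields
    [g = B f <= B (Bo g)]. *)
Lemma dual_galois_solution f g : lsc f -> B f = g -> B (Bo g) = g.
Proof.
move=> fl Bf; have [_ _ gal] := BBo; apply/funext => x; apply/eqP.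
rewrite eq_le; apply/andP; split.
  by have /lefP := (gal (Bo g) g (Bo_lsc g) I).2 (lexx _); apply.
rewrite -{1}Bf; apply: le_B => //; first exact: Bo_lsc.
by apply/lefP/(gal f g fl I); rewrite Bf.
Qed.

(** Membership says that the supremum defining [Bo g y] is attained at [x], so
    [Bo g y = bo y x (g x)], and [b x y] inverts [bo y x] on [S]. Conversely, [-oo < g x] forces
    [S (x, y)]. *)
Lemma subdiffP g x y : -oo < g x ->
  subdiff S bo g x y <-> b x y (Bo g y) = g x.
Proof.
have [_ _ _ BoE] := bbo => gx; split=> [[Sxy ymax]|bg].
  rewrite -[RHS](dual_galoisVK (kernel_galois x y) (b_bij _ _ Sxy)); congr b.
  apply/eqP; rewrite eq_le BoE ge_ereal_sup /=; last by move=> _ [x' _ <-].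
  by apply: ereal_sup_ubound; exists x.
have Sxy : S (x, y) by apply: (kernel_dom x y (Bo g y)); rewrite bg.
split=> // x'; rewrite -bg (dual_galoisK (kernel_galois x y) (b_bij _ _ Sxy)) BoE.
by apply: ereal_sup_ubound; exists x'.
Qed.

Lemma subdiff_ldom g x y : -oo < g x -> subdiff S bo g x y -> ldom (Bo g) y.
Proof.
move=> gx /(subdiffP g x y gx) bg; rewrite /ldom /= ltey; apply/eqP => Bogy.
by move: gx; rewrite -bg Bogy (dual_galois_pinfty (kernel_galois x y)) ltxx.
Qed.

Lemma subdiff_covering g (X' : set X) : X' `<=` dom_subdiff S bo g ->
  covering (subdiff_inv S bo g) (ldom (Bo g)) (X' `&` udom g).
Proof.
by move=> X'dom x [/X'dom[y xy] gx]; exists y => //; exact: subdiff_ldom xy.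
Qed.

(** If [b x y (f y) < a], some real [s < f y] already has [b x y s < a]. Near [y] this persists by
    continuity and [f] stays above [s]; antitonicity concludes. *)
Lemma usc_kernel_comp f x : continuous_in_second_variable b -> lsc f ->
  (forall y, -oo < f y) -> forall a, closed [set y | a <= b x y (f y)].
Proof.
move=> bc /lower_semicontinuousP fl fNy a.
have [->|] := eqVneq a -oo.
  rewrite (_ : [set _ | _] = setT); first exact: closedT.
  by apply/seteqP; split=> y //= _; exact: leNye.
rewrite -ltNye => a_gt; rewrite -openC openE => y /= /negP; rewrite -ltNge => bya.
(* Continuity is available at real [s] only. On [S] any real between [bo y x a] and [f y] serves,
   off [S] any real below [f y]. *)
have [s sf bs] : exists2 s : R, s%:E < f y & b x y s%:E < a.
  have [Sxy|nS] := pselect (S (x, y)); last first.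
    move: (fNy y); case: (f y) => [r _| _|//].
      by exists (r - 1)%R; rewrite ?b_Ny // lte_fin ltrBlDr ltrDl.
    by exists 0%R; rewrite ?b_Ny ?ltry.
  have K := dual_galoisK (kernel_galois x y) (b_bij _ _ Sxy).
  have VK := dual_galoisVK (kernel_galois x y) (b_bij _ _ Sxy).
  have lt_fy : bo y x a < f y.
    rewrite ltNge; apply/negP => /(dual_galois_anti (kernel_galois x y)).
    by rewrite VK leNgt bya.
  have [s /andP[a_s sf]] : exists s : R, bo y x a < s%:E < f y.
    move: lt_fy (fNy y); case: (bo y x a) => [r||]; case: (f y) => [t||] //.
    - rewrite lte_fin => rt _; exists ((r + t) / 2)%R.
      by rewrite !lte_fin !midf_lt.
    - by exists (r + 1)%R; rewrite lte_fin ltrDl ltr01 ltry.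
    - by exists (t - 1)%R; rewrite ltNyr lte_fin ltrBlDr ltrDl ltr01.
    - by exists 0%R; rewrite ltNyr ltry.
  by exists s => //; rewrite -[a]VK; exact: dual_galois_lt (b_bij _ _ Sxy) _ _ a_s.
have : nbhs y ((fun y' => b x y' s%:E) @^-1` [set t | t < a]
    `&` [set y' | s%:E < f y']).
  apply: filterI; last by apply: open_nbhs_nbhs; split=> //; exact: fl.
  apply: bc; apply: open_nbhs_nbhs; split=> //.
  exact: open_ereal_lt_ereal.
apply: filterS => y' /= [bsa sfy']; apply/negP; rewrite -ltNge.
by apply: le_lt_trans bsa; apply: (dual_galois_anti (kernel_galois x y')); exact: ltW.
Qed.

(** * Perturbations of a unique solution *)

Section unique_solution.
Context {g : X -> \bar R}.
Hypothesis solution_unique : exists! f : Y -> \bar R, lsc f /\ B f = g.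

Local Notation f := (Bo g).

Lemma B_Bo : B f = g.
Proof.
by have [h [[hl Bh] _]] := solution_unique; exact: dual_galois_solution hl Bh.
Qed.

Lemma solution_eq h : lsc h -> B h = g -> h = f.
Proof.
have [k [_ uk]] := solution_unique => hl Bh.
by rewrite -(uk h (conj hl Bh)) -(uk f (conj (Bo_lsc g) B_Bo)).
Qed.

Lemma range_kernelE x : ereal_sup (range (fun y => b x y (f y))) = g x.
Proof. by have [_ _ BE _] := bbo; rewrite -BE ?B_Bo //; exact: Bo_lsc. Qed.

Lemma kernel_le x y : b x y (f y) <= g x.
Proof. by rewrite -[leRHS]range_kernelE; apply: ereal_sup_ubound; exists y. Qed.

Lemma patch_le_B h U x : lsc (patch f U h) ->
  ereal_sup ((fun y => b x y (f y)) @` (~` U)) <= B (patch f U h) x.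
Proof.
move=> pl; apply: ge_ereal_sup => _ [y Uy <-].
by apply: le_trans (B_ge _ x y pl); rewrite /patch memNset.
Qed.

Lemma attained_patch h U x y : lsc (patch f U h) -> ~ U y ->
  b x y (f y) = g x -> g x <= B (patch f U h) x.
Proof.
move=> pl Uy <-; apply: le_trans (patch_le_B h U x pl).
by apply: ereal_sup_ubound; exists y.
Qed.

(** Compactness keeps the kernel values on [K] away from [g x], so the supremum is reached or
    approached off [K], where the patch equals [f]. *)
Lemma not_attained_patch h U K x : lsc (patch f U h) -> U `<=` K -> compact K ->
  (forall a, closed [set y | a <= b x y (f y)]) ->
  (forall y, K y -> b x y (f y) <> g x) -> g x <= B (patch f U h) x.
Proof.
move=> pl UK cK bc bg; apply: le_trans (patch_le_B h U x pl).
rewrite -[leLHS]range_kernelE;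
apply: (@le_trans _ _ (ereal_sup ((fun y => b x y (f y)) @` (~` K)))).
  apply: ereal_sup_off_compact => // y Ky.
  by rewrite range_kernelE lt_neqAle kernel_le andbT; apply/eqP/bg.
by apply: le_ereal_sup => _ [y Ky <-]; exists y => // /UK.
Qed.

(** Were [y] inessential because of [V], suprema over [X'] would be attained outside [V], and the
    patch would be a second solution, differing from [f] at [y]. *)
Lemma essential_of_patch (X' : set X) y : f y < +oo ->
  (forall V, open V -> V y ->
    (forall x, X' x -> -oo < g x -> exists2 z, ~ V z & b x z (f z) = g x) ->
    exists U h, [/\ open U /\ U y, lsc h, forall z, f z <= h z, f y < h y &
      forall x, -oo < g x -> g x <= B (patch f U h) x]) ->
  topologically_essential (subdiff_inv S bo g) (ldom f) (X' `&` udom g) y.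
Proof.
move=> fy perturb V Vo Vy; apply: contrapT => not_ess.
have [|U [h [[Uo Uy] hl fh fhy gB]]] := perturb V Vo Vy.
  move=> x X'x gx; apply: contrapT => no_z; apply: not_ess; exists x => //.
  move=> [z [fz notV]] /(subdiffP g x z gx) bz; apply: no_z; exists z => // Vz.
  by apply: notV.
have pl : lsc (patch f U h) by apply: lsc_patch => //; exact: Bo_lsc.
suff /solution_eq -/(_ pl) /(congr1 (@^~ y)) : B (patch f U h) = g.
  by rewrite /patch mem_set // => hf; rewrite hf ltxx in fhy.
(* One inequality is automatic: the patch dominates [f] and [B] is antitone. *)
apply/funext => x; apply/eqP; rewrite eq_le; apply/andP; split.
  rewrite -[leRHS]/(g x) -[X in _ <= X x]B_Bo; apply: le_B => // [|z]; first exact: Bo_lsc.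
  by rewrite /patch; case: ifP => _.
have [->|] := eqVneq (g x) -oo; first exact: leNye.
by rewrite -ltNye; exact: gB.
Qed.

(** Kernels send [+oo] to [-oo], so raising [f] to [+oo] removes points from the supremum. When [Y]
    is discrete, [K] is a singleton. *)
Lemma essential_dom_subdiff K y : compact K -> nbhs y K ->
  (forall x a, closed [set z | a <= b x z (f z)]) -> f y < +oo ->
  topologically_essential (subdiff_inv S bo g) (ldom f)
    (dom_subdiff S bo g `&` udom g) y.
Proof.
move=> cK yK bc fy; apply: essential_of_patch => // V Vo Vy att.
have Uo : open (V `&` K°) by apply: openI => //; exact: open_interior.
have pl : lsc (patch f (V `&` K°) (cst +oo)).
  apply: lsc_patch => //; [exact: Bo_lsc|exact: lsc_cst|move=> z; exact: leey].
exists (V `&` K°), (cst +oo); split=> //; first exact: lsc_cst.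
  by move=> z; exact: leey.
move=> x gx; have [xdom|xdom] := pselect (dom_subdiff S bo g x).
  have [z Vz bz] := att x xdom gx.
  by apply: attained_patch bz => // -[].
apply: (not_attained_patch _ _ K) => //.
  by move=> z [_ /interior_subset].
by move=> z _ bz; apply: xdom; exists z; apply/subdiffP.
Qed.

(** For a real [a < g x], the superlevel set [L] is compact by coercivity: on it [f y <= bo y x a],
    so [b z y (bo y x a) <= g z], which is bounded above near [x]. The maximum on [L] is the whole
    supremum. *)
Lemma idom_sub_dom_subdiff : coercive b bo -> continuous_in_second_variable b ->
  (forall y, -oo < f y) -> idom g `<=` dom_subdiff S bo g.
Proof.
move=> b_coer bc fNy x [[gy gNy] /ereal_inf_ltP[_ [V xV <-] gV]].
have [c Vc] : exists c : R, forall z, V z -> g z <= c%:E.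
  have gVz z : V z -> g z <= ereal_sup (g @` V).
    by move=> Vz; apply: ereal_sup_ubound; exists z.
  move: gV gVz; case: (ereal_sup _) => [c _ gc|//|_ gc]; first by exists c.
  by exists 0%R => z /gc /le_trans; apply; exact: leNye.
have [a ag] : exists a : R, a%:E < g x.
  move: gy gNy; rewrite /ldom /udom /=; case: (g x) => // r _ _.
  by exists (r - 1)%R; rewrite lte_fin ltrBlDr ltrDl.
pose L := [set y | a%:E <= b x y (f y)].
have Lc : closed L by apply: usc_kernel_comp => //; exact: Bo_lsc.
have L0 : L !=set0.
  by move: ag; rewrite -range_kernelE => /ereal_sup_gtP[_ [y _ <-] /ltW]; exists y.
have cL : compact L.
  have := b_coer x V a xV c; rewrite precompactE => /(subclosed_compact Lc); apply.
  apply: subset_trans (@subset_closure _ _) => y Ly /=.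
  apply: ge_ereal_sup => _ [z Vz <-]; apply: le_trans (Vc z Vz).
  apply: le_trans (kernel_le z y); apply: (dual_galois_anti (kernel_galois z y)).
  have Sxy : S (x, y).
    by apply: (kernel_dom x y (f y)); apply: lt_le_trans Ly; exact: ltNyr.
  rewrite leNgt; apply/negP => /(dual_galois_lt (kernel_galois x y) (b_bij _ _ Sxy)).
  by rewrite (dual_galoisVK (kernel_galois x y) (b_bij _ _ Sxy)) ltNge Ly.
have [y Ly ymax] := usc_compact_max (fun y => b x y (f y)) L
  (usc_kernel_comp f x bc (Bo_lsc g) fNy) cL L0.
exists y; apply/subdiffP => //; apply/eqP; rewrite eq_le kernel_le /=.
rewrite -[leLHS]range_kernelE; apply: ge_ereal_sup => _ [z _ <-].
have [/ymax //|/negP] := pselect (L z).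
by rewrite /L /= -ltNge => /ltW /le_trans; apply.
Qed.

(* Equality propagates from [idom g] to its closure because [g] is lower
   semicontinuous, whereas [B k] cannot be small at a single point of its
   domain. The assumptions on infinite values ensure that [g] and [B k] have
   the same domain, on which the quasi-continuity of [B k] is tested. *)
Lemma quasi_continuous_le_B k : regular B -> dom g `<=` closure (idom g) ->
  lsc k -> (forall y, f y <= k y) ->
  (forall x, -oo < g x -> -oo < B k x) -> (forall x, g x = +oo -> B k x = +oo) ->
  (forall x, idom g x -> g x <= B k x) -> forall x, -oo < g x -> g x <= B k x.
Proof.
move=> Breg g_cl kl fk BkNy Bky Bk_idom x gx; rewrite leNgt; apply/negP => Bkg.
have Bk_le z : B k z <= g z.
  by rewrite -[leRHS]/(g z) -[X in _ <= X z]B_Bo; apply: le_B => //; exact: Bo_lsc.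
have domE : dom (B k) = dom g.
  apply/seteqP; split=> z [zl zu]; split; rewrite /ldom /udom /=.
  - by rewrite ltey; apply: contraTneq zl => /Bky; rewrite /ldom /= => ->.
  - exact: lt_le_trans (Bk_le z).
  - exact: le_lt_trans (Bk_le z) _.
  - exact: BkNy.
have [gl _] := Breg f (Bo_lsc g); have [_ kq] := Breg k kl.
rewrite B_Bo in gl; move/lower_semicontinuousP : gl => gl.
have dgx : dom g x.
  split; rewrite /ldom /udom //= ltey.
  by apply: contraTneq Bkg => gy; rewrite gy (Bky _ gy).
have dx : dom (B k) x by rewrite domE.
have [c Bkc cg] : exists2 c : R, B k x < c%:E & c%:E < g x.
  case: dx dgx; rewrite /dom /ldom /udom /=; move: Bkg.
  case: (g x) => [t||]; case: (B k x) => [r||] //= + _ _ [] //.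
  rewrite lte_fin => rt _ _; exists ((r + t) / 2)%R;
    by rewrite lte_fin midf_lt.
pose d := @exist _ _ x (mem_set dx) : set_type (dom (B k)).
have Wd : nbhs d (set_val @^-1` [set z | c%:E < g z]).
  by apply: open_nbhs_nbhs; split=> //; exists [set z | c%:E < g z].
(* Quasi-continuity replaces [x] by a point [p] interior, relative to the domain, to [B k < c], with
   still [c < g p]. *)
have [p [pI cgp]] := kq _ (@open_ereal_lt_ereal R c%:E) d Bkc _ Wd.
move: pI; rewrite /interior nbhsE => -[_ [[A Ao <-] Ap] ABk].
have dgp : dom g (set_val p) by rewrite -domE; exact: set_valP.
have Np : nbhs (set_val p) (A `&` [set z | c%:E < g z]).
  by apply: open_nbhs_nbhs; split; [exact: openI|split].
(* Near [p], some [q] in [idom g] has [B k q < c < g q], against the bound on [idom g]. *)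
have [q [qg [Aq cgq]]] := g_cl _ dgp _ Np.
have dq : dom (B k) q by rewrite domE; case: qg.
have /= := ABk (@exist _ _ q (mem_set dq) : set_type (dom (B k))) Aq.
by apply/negP; rewrite -leNgt; apply: le_trans (Bk_idom _ qg); exact: ltW.
Qed.

(** Adding a real constant, unlike raising to [+oo], keeps values below [+oo], where kernels on [S]
    exceed [-oo]. *)
Lemma patch_addr_gtNy (e : R) U x : lsc (patch f U (fun y => f y + e%:E)) ->
  -oo < g x -> -oo < B (patch f U (fun y => f y + e%:E)) x.
Proof.
move=> pl; rewrite -range_kernelE => /ereal_sup_gtP[_ [y _ <-] by_gt].
apply: lt_le_trans (B_ge _ x y pl).
apply: kernel_gtNy; first exact: kernel_dom by_gt.
have fy : f y < +oo.
  rewrite ltey; apply: contraTneq by_gt => ->.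
  by rewrite (dual_galois_pinfty (kernel_galois x y)) ltxx.
by rewrite /patch; case: ifP => // _; exact: lte_add_pinfty (ltry e).
Qed.

(* Condition (C) bounds [g x - B k x], for [k] the perturbed solution. *)
Lemma condition_C_patch_pinfty (e : R) U x : (0 < e)%R ->
  ereal_sup [set b x y a%:E - b x y (a + e)%:E
            | y in U `&` xsection S x & a in [set: R]] < +oo ->
  (forall y, -oo < f y) -> lsc (patch f U (fun y => f y + e%:E)) ->
  g x = +oo -> B (patch f U (fun y => f y + e%:E)) x = +oo.
Proof.
set M := ereal_sup _ => e0 Mfin fNy pl gx; apply/eqP; rewrite -leye_eq leNgt; apply/negP.
set k := patch _ _ _ in pl *; move=> Bk.
have BkNy : -oo < B k x by apply: patch_addr_gtNy; rewrite // gx.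
have [r Bkr] : exists r : R, B k x = r%:E.
  by move: Bk BkNy; case: (B k x) => // r; exists r.
(* [m] is nonnegative so that [m + r] also bounds the terms off [U], where [k = f]. *)
have [m m0 Mm] : exists2 m : R, (0 <= m)%R & M <= m%:E.
  move: Mfin; case: (M) => [m _|//|_]; last by exists 0%R; rewrite ?leNye.
  by exists (Num.max 0 m)%R; rewrite ?lee_fin le_max lexx ?orbT.
suff : g x <= (m + r)%:E by rewrite gx.
rewrite -range_kernelE; apply: ge_ereal_sup => _ [y _ <-].
have ker : b x y (k y) <= r%:E by rewrite -Bkr; exact: B_ge.
have [Uy|nUy] := pselect (U y); last first.
  by move: ker; rewrite /k /patch memNset // => /le_trans; apply; rewrite lee_fin lerDr.
have [Sxy|nS] := pselect (S (x, y)); last by rewrite b_Ny // leNye.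
move: ker (fNy y); rewrite /k /patch mem_set //.
case fyE : (f y) => [a| |] // ker _; last first.
  by rewrite (dual_galois_pinfty (kernel_galois x y)) leNye.
rewrite EFinD; apply: (@le_trans _ _ (m%:E + b x y (a + e)%:E)); last exact: leeD2l.
rewrite -leeBlDr.
  apply: le_trans Mm; apply: ereal_sup_ubound.
  by exists y; [split=> //; apply/xsectionP|exists a].
rewrite fin_numElt kernel_gtNy ?ltry //=.
exact: le_lt_trans ker (ltry r).
Qed.

Lemma essential_idom y : regular B -> continuous_in_second_variable b ->
  (forall y, -oo < f y) -> dom g `<=` closure (idom g) ->
  locally_compact [set: Y] \/ condition_C S b -> f y < +oo ->
  topologically_essential (subdiff_inv S bo g) (ldom f) (idom g `&` udom g) y.
Proof.
move=> Breg bc fNy g_cl YC fy; apply: essential_of_patch => // V Vo Vy att.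
(* Attainment outside [V] settles [idom g] and quasi-continuity the rest of [dom g]; only the points
   with [g x = +oo] remain. *)
suff [U [e [Uo Uy UV e0 top]]] : exists U, exists e : R,
    [/\ open U, U y, U `<=` V, (0 < e)%R &
    lsc (patch f U (fun y => f y + e%:E)) -> forall x, g x = +oo ->
    B (patch f U (fun y => f y + e%:E)) x = +oo].
  have fe z : f z <= f z + e%:E by rewrite leeDl // lee_fin ltW.
  have hl := lsc_addr f e (Bo_lsc g).
  have pl := lsc_patch _ _ _ Uo (Bo_lsc g) hl fe.
  exists U, (fun y => f y + e%:E); split=> //.
    by rewrite lteDl ?lte_fin // fin_numElt fNy.
  apply: quasi_continuous_le_B => //.
  - by move=> z; rewrite /patch; case: ifP.
  - by move=> x; exact: patch_addr_gtNy.
  - exact: top.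
  - move=> x xg; have [_ gx] := xg.1; have [z Vz bz] := att x xg gx.
    by apply: attained_patch bz => // /UV.
have yV : nbhs y V by exact: open_nbhs_nbhs.
case: YC => [/(_ y I)[K]|[N [Nbasis NC]]].
  rewrite withinET => yK [cK _].
  (* Any positive constant works: [f > -oo] keeps kernel values below [+oo], so a supremum [+oo] is
     never attained. *)
  exists (V `&` K°), 1%R; split=> //.
    by apply: openI => //; exact: open_interior.
  move=> pl x gx; apply/eqP; rewrite -leye_eq -gx.
  apply: (not_attained_patch _ _ K) => //.
  - by move=> z [_ /interior_subset].
  - by move=> a; apply: usc_kernel_comp => //; exact: Bo_lsc.
  - by move=> z _; rewrite gx; apply/eqP; rewrite -ltey kernel_lty.
have [U [NU yU] UV] := Nbasis y V yV; have [e e0 UC] := NC U NU.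
exists U°, e; split=> //; first exact: open_interior.
  by move=> z /interior_subset /UV.
move=> pl x; apply: condition_C_patch_pinfty => //; apply: le_lt_trans (UC x).
apply: le_ereal_sup => _ [z [/interior_subset Uz Sz] [a _ <-]].
by exists z => //; exists a.
Qed.

End unique_solution.

End kernels.

Theorem theorem4p10 (R : realType) (X Y : topologicalType)
  (X0 : [set: X] !=set0) (Y0 : [set: Y] !=set0)
  (hX : hausdorff_space X) (hY : hausdorff_space Y)
  (B : (Y -> \bar R) -> (X -> \bar R)) (Bo : (X -> \bar R) -> (Y -> \bar R))
  (BBo : dual_galois (@lsc R Y) [set: X -> \bar R] B Bo)
  (b : X -> Y -> \bar R -> \bar R) (bo : Y -> X -> \bar R -> \bar R)
  (bbo : kernels B Bo b bo)
  (S : set (X * Y))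
  (A1 : forall x, xsection S x !=set0)
  (A2 : forall y, ysection S y !=set0)
  (A3 : forall x y, S (x, y) -> bijective (b x y))
  (A4 : forall x y, ~ S (x, y) -> forall s, b x y s = -oo)
  (g : X -> \bar R)
  (solution_unique : exists! f : Y -> \bar R, lsc f /\ B f = g)
  (X' : set X)
  (assertions :
    [\/ X' = dom_subdiff S bo g /\ discrete_topological_space Y,
        [/\ X' = dom_subdiff S bo g, locally_compact [set: Y],
            continuous_in_second_variable b & forall y, -oo < Bo g y] |
        [/\ X' = idom g, coercive b bo, regular B &
          [/\ continuous_in_second_variable b, forall y, -oo < Bo g y,
              dom g `<=` closure (idom g) &
              locally_compact [set: Y] \/ condition_C S b]]]) :
  topologically_minimal_covering (subdiff_inv S bo g) (ldom (Bo g))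
    (X' `&` udom g).
Proof.
have [[-> Ydisc]|[-> Yc bc fNy]|[-> bcoer Breg [bc fNy g_cl YC]]] := assertions; split.
- exact: (subdiff_covering bbo A3 A4).
- move=> y fy; apply: (essential_dom_subdiff BBo bbo A3 A4 solution_unique [set y]) => //.
  + exact: compact_set1.
  + by apply: open_nbhs_nbhs; split; [exact: Ydisc|].
  + by move=> x a; rewrite -openC; exact: Ydisc.
- exact: (subdiff_covering bbo A3 A4).
- move=> y fy; have [K] := Yc y I; rewrite withinET => yK [cK _].
  apply: (essential_dom_subdiff BBo bbo A3 A4 solution_unique K) => //.
  by move=> x a; apply: (usc_kernel_comp bbo A3 A4) => //; exact: (Bo_lsc BBo).
- by apply: (subdiff_covering bbo A3 A4); exact: (idom_sub_dom_subdiff BBo bbo A3 A4).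
- by move=> y; exact: (essential_idom BBo bbo A3 A4 solution_unique).
Qed.
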